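(* The universal Nielsen--Soelberg group $G_3=\langle x,y\mid (yx)^2(xy)^2,\ (xy^{-1})^2(xy)^2\rangle$ coincides with the group $S=\langle x,y\mid (xy)^2(xy^{-1})^2,\ (yx)^2(yx^{-1})^2\rangle$; that is, the assignment $x\mapsto x$, $y\mapsto y$ defines an isomorphism $S\to G_3$.
   Context: In a presentation $\langle x,y\mid R,R'\rangle$, the words $R,R'$ are relators (set equal to $1$). *)

(* Defs.v *)
From HB Require Import structures.
From mathcomp Require Import all_boot.
From mathcomp Require Import boolp.

Set Implicit Arguments.
Unset Strict Implicit.
Unset Printing Implicit Defensive.

Local Open Scope group_scope.
Local Open Scope quotient_scope.

Section FreeGroup.
Variable X : choiceType.

(* The letter (a, false) stands for a, and (a, true) for its formal inverse. *)
Definition word := seq (X * bool).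

Definition inv_letter (l : X * bool) : X * bool := (l.1, ~~ l.2).

Inductive free_equiv : word -> word -> Prop :=
  | free_equiv_refl u : free_equiv u u
  | free_equiv_sym u v : free_equiv u v -> free_equiv v u
  | free_equiv_trans v u w : free_equiv u v -> free_equiv v w -> free_equiv u w
  | free_equiv_cancel u v l :
      free_equiv (u ++ [:: l; inv_letter l] ++ v) (u ++ v).

Definition free_rel : rel word := fun u v => `[< free_equiv u v >].

Fact free_rel_refl : reflexive free_rel.
Proof. by move=> u; apply/asboolP; apply: free_equiv_refl. Qed.

Fact free_rel_sym : symmetric free_rel.
Proof. by move=> u v; apply/asboolP/asboolP; apply: free_equiv_sym. Qed.

Fact free_rel_trans : transitive free_rel.
Proof.
move=> v u w /asboolP uv /asboolP vw; apply/asboolP.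
exact: free_equiv_trans uv vw.
Qed.

Canonical free_eqv := EquivRel free_rel free_rel_refl free_rel_sym free_rel_trans.

Definition free_group := {eq_quot free_eqv}.
HB.instance Definition _ := Choice.on free_group.
HB.instance Definition _ := EqQuotient.on free_group.

Lemma free_groupP (u v : word) :
  \pi_free_group u = \pi_free_group v <-> free_equiv u v.
Proof.
by split=> [/eqmodP/asboolP | uv] //; apply/eqmodP/asboolP.
Qed.

Lemma free_equiv_cat (u u' v v' : word) :
  free_equiv u u' -> free_equiv v v' -> free_equiv (u ++ v) (u' ++ v').
Proof.
move=> uu' vv'; apply: (@free_equiv_trans (u' ++ v)).
  elim: uu' => {u u'} [u | u w _ | w u t _ + _ | u w l].
  - exact: free_equiv_refl.
  - exact: free_equiv_sym.
  - exact: free_equiv_trans.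
  - by rewrite -!catA; apply: free_equiv_cancel.
elim: vv' => {v v'} [v | v w _ | w v t _ + _ | v w l].
- exact: free_equiv_refl.
- exact: free_equiv_sym.
- exact: free_equiv_trans.
- by rewrite !(catA u'); apply: free_equiv_cancel.
Qed.

Definition inv_word (u : word) : word := rev (map inv_letter u).

Fact inv_letterK : involutive inv_letter.
Proof. by case=> a b; rewrite /inv_letter /= negbK. Qed.

Fact inv_wordK : involutive inv_word.
Proof.
by move=> u; rewrite /inv_word map_rev revK -map_comp map_id_in // => l _ /=;
  rewrite inv_letterK.
Qed.

Lemma free_equiv_inv (u v : word) :
  free_equiv u v -> free_equiv (inv_word u) (inv_word v).
Proof.
elim=> {u v} [u | u v _ | v u w _ + _ | u v l].
- exact: free_equiv_refl.
- exact: free_equiv_sym.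
- exact: free_equiv_trans.
rewrite /inv_word !map_cat !rev_cat -catA.
have := free_equiv_cancel (rev (map inv_letter v)) (rev (map inv_letter u)) l.
by rewrite /= {2}/rev /= inv_letterK.
Qed.

Lemma free_equivwV (u : word) : free_equiv (u ++ inv_word u) [::].
Proof.
elim/last_ind: u => [|u l IHu]; first exact: free_equiv_refl.
apply: free_equiv_trans IHu.
rewrite /inv_word map_rcons rev_rcons cat_rcons.
exact: (free_equiv_cancel _ _ l).
Qed.

Definition free_one : free_group := \pi_free_group [::].
Definition free_mul (g h : free_group) : free_group := \pi_free_group (repr g ++ repr h).
Definition free_inv (g : free_group) : free_group := \pi_free_group (inv_word (repr g)).

Fact free_repr (u : word) : free_equiv (repr (\pi_free_group u)) u.
Proof. by apply/free_groupP; rewrite reprK. Qed.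

Fact pi_free_mul (u v : word) :
  free_mul (\pi u) (\pi v) = \pi_free_group (u ++ v).
Proof. by apply/free_groupP; apply: free_equiv_cat; apply: free_repr. Qed.

Fact pi_free_inv (u : word) : free_inv (\pi u) = \pi_free_group (inv_word u).
Proof. by apply/free_groupP; apply: free_equiv_inv; apply: free_repr. Qed.

Fact free_mulA : associative free_mul.
Proof.
by elim/quotW=> u; elim/quotW=> v; elim/quotW=> w; rewrite !pi_free_mul catA.
Qed.

Fact free_mul1 : left_id free_one free_mul.
Proof. by elim/quotW=> u; rewrite pi_free_mul. Qed.

Fact free_mulr1 : right_id free_one free_mul.
Proof. by elim/quotW=> u; rewrite pi_free_mul cats0. Qed.

Fact free_mulV : left_inverse free_one free_inv free_mul.
Proof.
elim/quotW=> u; rewrite pi_free_inv pi_free_mul; apply/free_groupP.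
by have := free_equivwV (inv_word u); rewrite inv_wordK.
Qed.

Fact free_mulrV : right_inverse free_one free_inv free_mul.
Proof.
elim/quotW=> u; rewrite pi_free_inv pi_free_mul.
by apply/free_groupP/free_equivwV.
Qed.

HB.instance Definition _ :=
  isGroup.Build free_group free_mulA free_mul1 free_mulr1 free_mulV free_mulrV.

Definition free_gen (a : X) : free_group := \pi_free_group [:: (a, false)].

End FreeGroup.

Section NormalQuotient.
Variables (G : groupType) (A : G -> Prop).

Inductive normal_closure : G -> Prop :=
  | normal_closure_mem g : A g -> normal_closure g
  | normal_closure1 : normal_closure 1
  | normal_closureM g h :
      normal_closure g -> normal_closure h -> normal_closure (g * h)
  | normal_closureV g : normal_closure g -> normal_closure g^-1
  | normal_closureJ g h : normal_closure g -> normal_closure (g ^ h).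

Definition nquot_rel : rel G := fun g h => `[< normal_closure (g^-1 * h) >].

Fact nquot_rel_refl : reflexive nquot_rel.
Proof. by move=> g; apply/asboolP; rewrite mulVg; apply: normal_closure1. Qed.

Fact nquot_rel_sym : symmetric nquot_rel.
Proof.
by move=> g h; apply/asboolP/asboolP => /normal_closureV; rewrite invgM invgK.
Qed.

Fact nquot_rel_trans : transitive nquot_rel.
Proof.
move=> h g k /asboolP gh /asboolP hk; apply/asboolP.
by have := normal_closureM gh hk; rewrite mulgA mulgK.
Qed.

Canonical nquot_eqv :=
  EquivRel nquot_rel nquot_rel_refl nquot_rel_sym nquot_rel_trans.

Definition nquot := {eq_quot nquot_eqv}.
HB.instance Definition _ := Choice.on nquot.
HB.instance Definition _ := EqQuotient.on nquot.

Lemma nquotP (g h : G) :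
  \pi_nquot g = \pi_nquot h <-> normal_closure (g^-1 * h).
Proof. by split=> [/eqmodP/asboolP | gh] //; apply/eqmodP/asboolP. Qed.

Definition nquot_one : nquot := \pi_nquot 1.
Definition nquot_mul (a b : nquot) : nquot := \pi_nquot (repr a * repr b).
Definition nquot_inv (a : nquot) : nquot := \pi_nquot (repr a)^-1.

Fact nquot_repr (g : G) : normal_closure ((repr (\pi_nquot g))^-1 * g).
Proof. by apply/nquotP; rewrite reprK. Qed.

Fact pi_nquot_mul (g h : G) :
  nquot_mul (\pi g) (\pi h) = \pi_nquot (g * h).
Proof.
apply/nquotP; move: (nquot_repr g) (nquot_repr h).
set g' := repr _; set h' := repr _ => gg hh.
have := normal_closureM (normal_closureJ h' gg) hh.
by rewrite /conjg invgM !mulgA mulgK.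
Qed.

Fact pi_nquot_inv (g : G) : nquot_inv (\pi g) = \pi_nquot g^-1.
Proof.
apply/nquotP; move: (nquot_repr g); set g' := repr _ => gg.
have := normal_closureJ g'^-1 (normal_closureV gg).
by rewrite /conjg invgM !invgK !mulgA mulgK.
Qed.

Fact nquot_mulA : associative nquot_mul.
Proof.
by elim/quotW=> g; elim/quotW=> h; elim/quotW=> k; rewrite !pi_nquot_mul mulgA.
Qed.

Fact nquot_mul1 : left_id nquot_one nquot_mul.
Proof. by elim/quotW=> g; rewrite pi_nquot_mul mul1g. Qed.

Fact nquot_mulr1 : right_id nquot_one nquot_mul.
Proof. by elim/quotW=> g; rewrite pi_nquot_mul mulg1. Qed.

Fact nquot_mulV : left_inverse nquot_one nquot_inv nquot_mul.
Proof. by elim/quotW=> g; rewrite pi_nquot_inv pi_nquot_mul mulVg. Qed.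

Fact nquot_mulrV : right_inverse nquot_one nquot_inv nquot_mul.
Proof. by elim/quotW=> g; rewrite pi_nquot_inv pi_nquot_mul mulgV. Qed.

HB.instance Definition _ :=
  isGroup.Build nquot nquot_mulA nquot_mul1 nquot_mulr1 nquot_mulV nquot_mulrV.

End NormalQuotient.

Section Presentation.
Variables (X : choiceType) (R : seq (free_group X)).

Definition presented := nquot (fun r => r \in R).
HB.instance Definition _ := Group.on presented.
HB.instance Definition _ := EqQuotient.on presented.

Definition presented_gen (a : X) : presented := \pi_presented (free_gen a).

End Presentation.

(* The two generators are indexed by bool: x by false, y by true. *)
Section TwoGenerators.
Let x : free_group bool := free_gen false.
Let y : free_group bool := free_gen true.

Definition G3_relators : seq (free_group bool) :=
  [:: (y * x) ^+ 2 * (x * y) ^+ 2; (x * y^-1) ^+ 2 * (x * y) ^+ 2].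

Definition S_relators : seq (free_group bool) :=
  [:: (x * y) ^+ 2 * (x * y^-1) ^+ 2; (y * x) ^+ 2 * (y * x^-1) ^+ 2].

End TwoGenerators.

Definition groupG3 := presented G3_relators.
Definition groupS := presented S_relators.
HB.instance Definition _ := Group.on groupG3.
HB.instance Definition _ := Group.on groupS.

Definition x_G3 : groupG3 := presented_gen G3_relators false.
Definition y_G3 : groupG3 := presented_gen G3_relators true.
Definition x_S : groupS := presented_gen S_relators false.
Definition y_S : groupS := presented_gen S_relators true.

(* Main.v *)
Require Import Defs.
From HB Require Import structures.
From mathcomp Require Import all_boot.

(** With [r1 = (xy^-1)^2 (xy)^2] and [r2 = (yx)^2 (xy)^2] the relators of [G_3],
    the relators of [S] are the conjugate [r1 ^ (xy)^-2] and the product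
    [r2 r1^-1], because [(xy^-1)^-2 = (yx^-1)^2]. *)

Set Implicit Arguments.
Unset Strict Implicit.
Unset Printing Implicit Defensive.

Local Open Scope group_scope.
Local Open Scope quotient_scope.

(** This reduces a comparison of normal closures to a check on the generating elements, here the
    finitely many relators. *)
Lemma normal_closure_min (G : groupType) (A B : G -> Prop) :
  (forall g, A g -> normal_closure B g) ->
  forall g, normal_closure A g -> normal_closure B g.
Proof.
move=> AB g; elim=> {g} [g /AB // | | g h _ + _ | g _ | g h _].
- exact: normal_closure1.
- exact: normal_closureM.
- exact: normal_closureV.
- exact: normal_closureJ.
Qed.

Definition relators_follow (X : choiceType) (R R' : seq (free_group X)) :=
  forall r, r \in R -> normal_closure (fun r => r \in R') r.

Section PresentedMap.
Variables (X : choiceType) (R R' : seq (free_group X)).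

(* The proof argument lets the morphism instance be inferred. *)
Definition presented_map of relators_follow R R' :=
  fun g : presented R => \pi_(presented R') (repr g).

Hypothesis sRR' : relators_follow R R'.

(** The chosen [repr] differs from [w] by an element of the normal closure of [R], which [sRR']
    places in that of [R']. *)
Lemma presented_map_pi (w : free_group X) :
  presented_map sRR' (\pi_(presented R) w) = \pi_(presented R') w.
Proof.
by apply/(nquotP (fun r => r \in R'))/(normal_closure_min sRR')/nquot_repr.
Qed.

Lemma presented_mapM : {morph presented_map sRR' : g h / g * h}.
Proof.
elim/quotW=> u; elim/quotW=> v.
rewrite [\pi_(presented R) u * _](pi_nquot_mul (fun r => r \in R)).
by rewrite !presented_map_pi [RHS](pi_nquot_mul (fun r => r \in R')).
Qed.

HB.instance Definition _ := isMultiplicative.Build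
  (presented R) (presented R') (presented_map sRR') presented_mapM.

End PresentedMap.

Lemma presented_mapK (X : choiceType) (R R' : seq (free_group X))
    (sRR' : relators_follow R R') (sR'R : relators_follow R' R) :
  cancel (presented_map sRR') (presented_map sR'R).
Proof.
elim/quotW=> w; transitivity (presented_map sR'R (\pi_(presented R') w)).
  by congr presented_map; apply: presented_map_pi.
exact: presented_map_pi.
Qed.

Lemma presented_isom (X : choiceType) (R R' : seq (free_group X)) :
  relators_follow R R' -> relators_follow R' R ->
  exists f : {multiplicative presented R -> presented R'},
    bijective f /\ forall a, f (presented_gen R a) = presented_gen R' a.
Proof.
move=> sRR' sR'R; exists (presented_map sRR'); split=> [|a].
  by exists (presented_map sR'R); apply: presented_mapK.
exact: presented_map_pi.
Qed.

Section Relators.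
Variables (G : groupType) (x y : G).

(** Conjugating [a * b] by [b^-1] gives [b * a]. *)
Lemma relator1E :
  (x * y) ^+ 2 * (x * y^-1) ^+ 2
  = ((x * y^-1) ^+ 2 * (x * y) ^+ 2) ^ ((x * y) ^+ 2)^-1.
Proof. by rewrite conjgE invgK mulgK. Qed.

Lemma relator2E :
  (y * x) ^+ 2 * (y * x^-1) ^+ 2
  = (y * x) ^+ 2 * (x * y) ^+ 2 * ((x * y^-1) ^+ 2 * (x * y) ^+ 2)^-1.
Proof.
by rewrite [in RHS]invgM [RHS]mulgA mulgK -expVgn invgM invgK.
Qed.

End Relators.

Theorem lemma5p2 :
  exists f : {multiplicative groupS -> groupG3},
    [/\ bijective f, f x_S = x_G3 & f y_S = y_G3].
Proof.
have [r|r|f [bij_f f_gen]] := @presented_isom bool S_relators G3_relators.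
(* In the order of [G3_relators], [G1] concerns [r2] and [G2] concerns [r1]. *)
- have G1 := @normal_closure_mem _ (fun r => r \in G3_relators) _ (mem_head _ _).
  have G2 := @normal_closure_mem _ (fun r => r \in G3_relators) _ (mem_last _ _).
  rewrite !inE => /orP[]/eqP->.
    by rewrite relator1E; apply: normal_closureJ.
  by rewrite relator2E; apply: normal_closureM => //; apply: normal_closureV.
- have S1 := @normal_closure_mem _ (fun r => r \in S_relators) _ (mem_head _ _).
  have S2 := @normal_closure_mem _ (fun r => r \in S_relators) _ (mem_last _ _).
  (* Conjugating by [(xy)^2] undoes the conjugation in [relator1E] and recovers [r1]. *)
  have G2 := normal_closureJ ((free_gen false * free_gen true) ^+ 2) S1.
  rewrite relator1E conjgKV in G2.
  rewrite !inE => /orP[]/eqP-> //.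
  (* The second relator of [S] is [r2 r1^-1], so multiplying it by [r1] on the right leaves [r2]. *)
  have := normal_closureM S2 G2.
  by rewrite /= relator2E mulgVK.
by exists f; split=> //; apply: f_gen.
Qed.
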